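(* In the edge-distinguishing game (EDGe) played on the Moser spindle $M$ (with $\lambda(M)$ colors), Player 1 has a winning strategy.
   Context: The Moser spindle $M$ is the graph with vertices $v_1,\dots,v_7$ and the 11 edges $v_1v_2, v_1v_5, v_1v_6, v_1v_7, v_2v_7, v_5v_6, v_2v_3, v_3v_7, v_4v_5, v_4v_6, v_3v_4$. For a positive integer $k$ let $[k]=\{1,\dots,k\}$. A $k$-coloring $c:V(G)\to[k]$ induces $c'(\{u,v\})=\{c(u),c(v)\}$ (a multiset); $c$ is edge-distinguishing if $c'$ is injective, and $\lambda(G)$ is the least $k$ admitting such a coloring. A partial coloring on $U\subseteq V(G)$ has partial induced edge coloring on $G[U]$. EDGe on $G$: two players, Player 1 first, alternately color an uncolored vertex with a color from $[\lambda(G)]$; a move is legal iff afterwards the partial induced edge coloring of the colored vertices is injective. The player making the last legal move wins. A winning strategy guarantees a win regardless of the opponent's play. *)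

(* Defs.v *)
From mathcomp Require Import all_boot.

Set Implicit Arguments.
Unset Strict Implicit.
Unset Printing Implicit Defensive.

Record sgraph := SGraph {
  vertex :> finType;
  adj : rel vertex;
  adj_sym : symmetric adj;
  adj_irr : irreflexive adj }.

Section EdgeColoring.

Context (G : sgraph).

(* Injectivity of the induced edge coloring on the edges of G[U]; the multiset
   {c u, c v} is the sequence [:: c u; c v] taken up to permutation. *)
Definition edge_distinguishing_on (C : eqType) (U : {set G}) (c : G -> C) : bool :=
  [forall u in U, forall v in U, forall w in U, forall x in U,
    adj u v ==> adj w x ==> perm_eq [:: c u; c v] [:: c w; c x] ==>
      ([set u; v] == [set w; x])].

(* The color set [k] is represented by 'I_k. *)
Definition edge_distinguishing (k : nat) (c : G -> 'I_k) : bool :=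
  edge_distinguishing_on [set: G] c.

Definition edge_distinguishable (k : nat) : bool :=
  (0 < k) && [exists c : {ffun G -> 'I_k}, edge_distinguishing c].

Lemma edge_distinguishable_ex : exists k, edge_distinguishable k.
Proof.
exists #|G|.+1; apply/existsP.
pose f (u : G) : 'I_#|G|.+1 := widen_ord (leqnSn _) (enum_rank u).
have f_inj : injective f.
  by move=> u v /(congr1 val) /= /val_inj /enum_rank_inj.
exists [ffun u => f u].
apply/forall_inP=> u _; apply/forall_inP=> v _.
apply/forall_inP=> w _; apply/forall_inP=> x _.
apply/implyP=> _; apply/implyP=> _; apply/implyP; rewrite !ffunE => eqc.
apply/eqP/setP=> y; move/perm_mem/(_ (f y)): eqc.
by rewrite !inE !(inj_eq f_inj).
Qed.

Definition lambda : nat := ex_minn edge_distinguishable_ex.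

(* A partial coloring; None marks an uncolored vertex. *)
Definition partial_coloring (k : nat) := G -> option 'I_k.

Definition colored (k : nat) (p : partial_coloring k) : {set G} :=
  [set v | p v != None].

Definition partial_edge_distinguishing (k : nat) (p : partial_coloring k) : bool :=
  edge_distinguishing_on (colored p) p.

End EdgeColoring.

Section EDGe.

Context (G : sgraph).

Definition move := (G * 'I_(lambda G))%type.

Definition position := partial_coloring G (lambda G).

Definition play_move (p : position) (m : move) : position :=
  fun u => if u == m.1 then Some m.2 else p u.

Definition legal (p : position) (m : move) : bool :=
  (m.1 \notin colored p) && partial_edge_distinguishing (play_move p m).

(* A history is the chronological list of moves made; Player 1 makes the moves
   preceded by an even number of moves. *)
Definition history := seq move.

Definition position_after (h : history) : position :=
  foldl play_move (fun=> None) h.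

Definition legal_history (h : history) : Prop :=
  forall h1 m h2, h = h1 ++ m :: h2 -> legal (position_after h1) m.

Definition game_over (h : history) : Prop :=
  forall m, ~~ legal (position_after h) m.

Definition player1_to_move (h : history) : bool := ~~ odd (size h).

Definition player1_made_last_move (h : history) : bool := odd (size h).

Definition strategy := history -> move.

Definition player1_follows (s : strategy) (h : history) : Prop :=
  forall h1 m h2, h = h1 ++ m :: h2 -> player1_to_move h1 -> m = s h1.

(* The first clause is needed: a strategy prescribing an illegal move would
   otherwise have no completed play and satisfy the second one vacuously. *)
Definition player1_winning_strategy (s : strategy) : Prop :=
  forall h, legal_history h -> player1_follows s h ->
    (player1_to_move h -> ~ game_over h -> legal (position_after h) (s h)) /\
    (game_over h -> player1_made_last_move h).

End EDGe.

(* The vertex v_i is the ordinal with value i - 1. *)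
Definition moser_edges : seq (nat * nat) :=
  [:: (1, 2); (1, 5); (1, 6); (1, 7); (2, 7); (5, 6);
      (2, 3); (3, 7); (4, 5); (4, 6); (3, 4)].

Definition moser_adj : rel 'I_7 := fun u v =>
  ((u.+1, v.+1) \in moser_edges) || ((v.+1, u.+1) \in moser_edges).

Lemma moser_adj_sym : symmetric moser_adj.
Proof. by move=> u v; rewrite /moser_adj orbC. Qed.

Lemma moser_adj_irr : irreflexive moser_adj.
Proof. by case; do 7?[case=> //]. Qed.

Definition moser_spindle : sgraph := SGraph moser_adj_sym moser_adj_irr.

(* Main.v *)
(** Player 1 opens by giving v1 some color a; a vertex with two neighbors of the
    same color can no longer be colored. Up to symmetry, Player 2 has four
    answers. If v7 gets a, the reply v4 := a kills every remaining vertex; so does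
    v2 := a if v4 gets a. If v7 gets b <> a, the reply v4 := a kills v5 and v6, and
    Player 1 colors whichever of v2, v3 Player 2 leaves. If v4 gets b <> a, the
    reply v3 := a kills v2 and v7, and Player 1 colors whichever of v5, v6 is left.
    So Player 1 wins within five moves. This game tree, and the exhaustive search
    showing that five colors do not suffice, so that lambda = 6, are evaluated on
    positions encoded as lists of numbers. *)

Require Import Defs.
From mathcomp Require Import all_boot.

Set Implicit Arguments.
Unset Strict Implicit.
Unset Printing Implicit Defensive.

(** * Unordered pairs *)

Definition same_pair (C : eqType) (a b c d : C) : bool :=
  ((a == c) && (b == d)) || ((a == d) && (b == c)).

Lemma perm_eq_pair (C : eqType) (a b c d : C) :
  perm_eq [:: a; b] [:: c; d] = same_pair a b c d.
Proof.
rewrite /same_pair; apply/idP/idP => [|/orP[]/andP[/eqP-> /eqP->] //]; last first.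
  by rewrite (perm_catC [:: d] [:: c]).
move=> ab_cd; have: a \in [:: c; d] by rewrite -(perm_mem ab_cd) !inE eqxx.
rewrite !inE => /orP[]/eqP ac; move: ab_cd; rewrite -ac eqxx.
  by rewrite perm_cons => /perm_mem/(_ b); rewrite !inE eqxx /= => <-.
rewrite perm_sym (perm_catC [:: c] [:: a]) perm_cons.
by move=> /perm_mem/(_ c); rewrite !inE eqxx eq_sym => <-; rewrite orbT.
Qed.

Lemma set2_eq (T : finType) (u v w x : T) :
  ([set u; v] == [set w; x]) = same_pair u v w x.
Proof.
rewrite /same_pair; apply/eqP/orP => [|[]/andP[/eqP-> /eqP->] //]; last exact: setUC.
move=> /setP uv_wx; move: (uv_wx u) (uv_wx v) (uv_wx w) (uv_wx x).
rewrite !inE !eqxx ?orbT /= (eq_sym w u) (eq_sym w v) (eq_sym x u) (eq_sym x v).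
case: (u == w); case: (v == x); case: (u == x); case: (v == w) => //=; by auto.
Qed.

(** * From lost positions to a winning strategy *)

(* Player 2 is to move in the positions satisfying [lost]. *)
Lemma lost_winning_strategy (G : sgraph) (lost : position G -> bool) :
  (forall p m, lost p -> legal p m ->
    exists m', legal (play_move p m) m' && lost (play_move (play_move p m) m')) ->
  (exists m : move G,
    legal (position_after [::]) m && lost (play_move (position_after [::]) m)) ->
  exists s : strategy G, player1_winning_strategy s.
Proof.
move=> lost_reply opening.
have [m0 _] := opening.
pose good (h : history G) (m : move G) :=
  legal (position_after h) m && lost (play_move (position_after h) m).
(* [m0] is only a default for histories without a good move. *)
pose s (h : history G) : move G := odflt m0 [pick m | good h m].
have s_good h : (exists m, good h m) -> good h (s h).
  by move=> [m hm]; rewrite /s; case: pickP => [//|/(_ m)]; rewrite hm.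
(* Invariant: after a move of Player 1 the position is lost for Player 2; before one, [s] has a good
   move. *)
have inv h : legal_history h -> player1_follows s h ->
    if odd (size h) then lost (position_after h) else good h (s h).
  elim/last_ind: h => [|h m IH] hl hs; first exact/s_good/opening.
  have hm : legal (position_after h) m.
    by apply: (hl h m [::]); rewrite cats1.
  have {IH} := IH _ _; rewrite size_rcons /=.
  case: ifP => odd_h IH.
    apply: s_good; rewrite /good /position_after foldl_rcons.
    apply: lost_reply hm; apply: IH => [h1 m1 h2 e | h1 m1 h2 e].
      by apply: (hl h1 m1 (rcons h2 m)); rewrite e rcons_cat.
    by apply: (hs h1 m1 (rcons h2 m)); rewrite e rcons_cat.
  rewrite /position_after foldl_rcons (hs h m [::]) ?cats1 //; last first.
    by rewrite /player1_to_move odd_h.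
  have /andP[] // : good h (s h).
  apply: IH => [h1 m1 h2 e | h1 m1 h2 e].
    by apply: (hl h1 m1 (rcons h2 m)); rewrite e rcons_cat.
  by apply: (hs h1 m1 (rcons h2 m)); rewrite e rcons_cat.
exists s => h hl hs; have := inv h hl hs.
rewrite /player1_to_move /player1_made_last_move.
by case: odd => // /andP[leg _]; split=> // /(_ (s h)); rewrite leg.
Qed.

(** * Searches on encoded positions *)

(* A partial coloring of the spindle is encoded by the list of its seven
   colors; colors are shifted by one, and 0 marks an uncolored vertex. *)
Definition code_color (p : seq nat) (i : nat) : nat := nth 0 p i.-1.

Definition code_proper (p : seq nat) : bool :=
  let E := [seq e <- moser_edges |
             (code_color p e.1 != 0) && (code_color p e.2 != 0)] in
  all (fun e => all (fun f =>
    same_pair (code_color p e.1) (code_color p e.2)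
              (code_color p f.1) (code_color p f.2) ==> (e == f)) E) E.

Definition code_moves (k : nat) (p : seq nat) : seq (seq nat) :=
  [seq q <- [seq set_nth 0 p i c | i <- [seq i <- iota 0 7 | nth 0 p i == 0],
                                   c <- iota 1 k] | code_proper q].

(** A stuck Player 2 loses because [all] is vacuous. For positive [n], Player 2 gets at most n - 1
    further moves; the palette size 6 anticipates the value of [lambda]. *)
Fixpoint code_lost (n : nat) (p : seq nat) : bool :=
  if n is n'.+1 then
    all (fun q => has (code_lost n') (code_moves 6 q)) (code_moves 6 p)
  else false.

(** Backtracking in vertex order: a prefix is abandoned once two of its edges clash. *)
Fixpoint code_colorable (k n : nat) (p : seq nat) : bool :=
  if n is n'.+1 then
    has (fun c => code_proper (rcons p c) && code_colorable k n' (rcons p c))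
        (iota 1 k)
  else true.

(** Lets a single depth serve as the invariant of the whole game, although each round lowers it. *)
Lemma code_lostS n p : code_lost n p -> code_lost n.+1 p.
Proof.
elim: n p => // n IH p; apply: sub_all => q.
by apply: sub_has => r; apply: IH.
Qed.

Lemma code_properP p : reflect
  {in moser_edges &, forall e f,
    code_color p e.1 != 0 -> code_color p e.2 != 0 ->
    code_color p f.1 != 0 -> code_color p f.2 != 0 ->
    same_pair (code_color p e.1) (code_color p e.2)
              (code_color p f.1) (code_color p f.2) -> e = f}
  (code_proper p).
Proof.
apply: (iffP allP) => [P e f eE fE e1 e2 f1 f2 ef | P e].
  have /P/allP/(_ f) : e \in [seq e <- moser_edges |
      (code_color p e.1 != 0) && (code_color p e.2 != 0)].
    by rewrite mem_filter e1 e2.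
  by rewrite mem_filter f1 f2 ef => /(_ fE)/eqP.
rewrite mem_filter => /andP[/andP[e1 e2] eE]; apply/allP=> f.
rewrite mem_filter => /andP[/andP[f1 f2] fE].
by apply/implyP => ef; rewrite (P e f).
Qed.

(** An edge colored under [q] has the same pair of colors under [p], so no new clash arises. *)
Lemma code_proper_sub p q :
  (forall i, nth 0 q i != 0 -> nth 0 q i = nth 0 p i) ->
  code_proper p -> code_proper q.
Proof.
move=> qp /code_properP P; apply/code_properP => e f eE fE.
rewrite /code_color => e1 e2 f1 f2.
rewrite (qp _ e1) (qp _ e2) (qp _ f1) (qp _ f2).
by apply: P => //; rewrite /code_color -qp.
Qed.

(** The prefixes of [p] form a successful branch of the search. *)
Lemma code_colorableP k p : {subset p <= iota 1 k} -> code_proper p ->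
  code_colorable k (size p) [::].
Proof.
move=> sub_p proper_p; rewrite -[[::]](take0 p).
suff: forall n i, n + i = size p -> code_colorable k n (take i p).
  by move=> H; apply: H; rewrite addn0.
elim=> //= n IH i ni; have lt_i : i < size p by rewrite -ni ltnS leq_addl.
apply/hasP; exists (nth 0 p i); first exact/sub_p/mem_nth.
rewrite -take_nth // IH ?addnS // andbT; apply: code_proper_sub proper_p => j.
have [lt_j | ge_j] := ltnP j i.+1; first by rewrite nth_take.
(* Beyond the prefix [nth] returns 0, the mark of an uncolored vertex. *)
by rewrite nth_default // size_take_min (leq_trans (geq_minl _ _)).
Qed.

(** Evaluates the game tree after v1 receives its color; depth 3 leaves Player 2 two moves, hence
    five moves in all. *)
Lemma opening_lost : code_lost 3 [:: 1; 0; 0; 0; 0; 0; 0].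
Proof. by lazy. Qed.

Lemma not_code_colorable5 : code_colorable 5 7 [::] = false.
Proof. by lazy. Qed.

(** * Faithfulness of the encoding *)

Definition code (c : 'I_7 -> nat) : seq nat := [seq c i | i <- enum 'I_7].

Lemma size_code c : size (code c) = 7.
Proof. by rewrite size_map size_enum_ord. Qed.

Lemma nth_code c (i : 'I_7) : nth 0 (code c) i = c i.
Proof. by rewrite (nth_map i) ?size_enum_ord // nth_ord_enum. Qed.

Lemma moser_edge_ord e : e \in moser_edges ->
  exists u v : 'I_7, [/\ e = (u.+1, v.+1), u < v & @adj moser_spindle u v].
Proof.
move=> eE; have /allP/(_ e eE) :
  all (fun e => [&& 0 < e.1, e.1 < e.2 & e.2 < 8]) moser_edges by [].
case: e eE => [[|u] [|v]] //= uvE /andP[uv lt_v].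
move: (lt_v : v < 7) => {}lt_v.
have lt_u : u < 7 := @ltn_trans v _ _ uv lt_v.
by exists (Ordinal lt_u), (Ordinal lt_v); split=> //=; rewrite /moser_adj uvE.
Qed.

(** Only coincidences between colors matter, so a numbering [d] with the same coincidences on [U],
    and zero exactly off [U], can replace [c]. *)
Lemma edge_distinguishing_code (C : eqType) (U : {set moser_spindle})
    (c : moser_spindle -> C) (d : 'I_7 -> nat) :
  (forall u, (u \in U) = (d u != 0)) ->
  {in U &, forall u v, (d u == d v) = (c u == c v)} ->
  edge_distinguishing_on U c = code_proper (code d).
Proof.
move=> Ud cd; apply/idP/code_properP => [H e f | H].
  move=> /moser_edge_ord[u [v [-> uv auv]]] /moser_edge_ord[w [x [-> wx awx]]].
  rewrite /code_color /= !nth_code -!Ud => uU vU wU xU.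
  rewrite /same_pair !cd // -/(same_pair _ _ _ _) -perm_eq_pair => E.
  move/forall_inP/(_ u uU)/forall_inP/(_ v vU): H.
  move/forall_inP/(_ w wU)/forall_inP/(_ x xU).
  rewrite auv awx E /= set2_eq => /orP[]/andP[/eqP uw /eqP vx].
    by rewrite uw vx.
  (* A reversed match is impossible, as listed edges have their smaller endpoint first. *)
  by move: uv; rewrite uw vx ltnNge ltnW.
apply/forall_inP=> u uU; apply/forall_inP=> v vU.
apply/forall_inP=> w wU; apply/forall_inP=> x xU.
apply/implyP=> auv; apply/implyP=> awx; apply/implyP.
rewrite perm_eq_pair /same_pair -!cd // => E; rewrite set2_eq.
have {H} H a b a' b' : a \in U -> b \in U -> a' \in U -> b' \in U ->
    (a.+1, b.+1) \in moser_edges -> (a'.+1, b'.+1) \in moser_edges ->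
    same_pair (d a) (d b) (d a') (d b') -> same_pair a b a' b'.
  move=> aU bU a'U b'U abE abE' E'.
  have := H _ _ abE abE'; rewrite /code_color /= !nth_code -!Ud.
  move=> /(_ aU bU a'U b'U E') [/val_inj-> /val_inj->].
  by rewrite /same_pair !eqxx.
rewrite /same_pair in H E *.
(* Each edge may be listed in either direction; the four cases swap endpoints accordingly. *)
move: auv awx; rewrite /adj /= /moser_adj => /orP[] uvE /orP[] wxE.
- exact: H.
- by rewrite orbC; apply: H => //; rewrite orbC.
- rewrite orbC andbC [X in _ || X]andbC; apply: H => //.
  by rewrite orbC andbC [X in _ || X]andbC.
- rewrite andbC [X in _ || X]andbC; apply: H => //.
  by rewrite andbC [X in _ || X]andbC.
Qed.

(** * The value of [lambda] for the spindle *)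

Lemma lambda_moser : lambda moser_spindle = 6.
Proof.
rewrite /lambda; case: ex_minnP => k /andP[k_gt0 /existsP[c hc]] min_k.
apply/eqP; rewrite eqn_leq; apply/andP; split.
  apply: min_k; apply/existsP.
  (* Only v3 and v4 share a color, and they are adjacent: their edge alone gets a repeated color. *)
  pose p := [:: 0; 1; 2; 2; 3; 4; 5].
  exists [ffun i : 'I_7 => inord (nth 0 p i)].
  pose d (i : 'I_7) := (nth 0 p i).+1.
  rewrite /edge_distinguishing (edge_distinguishing_code (d := d)).
  - by rewrite /code (map_comp (fun i => (nth 0 p i).+1) val) val_enum_ord.
  - by move=> u; rewrite inE.
  - move=> u v _ _; rewrite !ffunE.
    have lt6 i : nth 0 p i < 6 by do 7?case: i => [|i] //=; rewrite nth_nil.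
    by rewrite -val_eqE /= !inordK.
(* With fewer than six colors, the shifted values lie between 1 and 5, and the search would
   succeed. *)
rewrite leqNgt; apply/negP => lt_k.
pose d (i : 'I_7) := (c i).+1.
have := hc; rewrite /edge_distinguishing (edge_distinguishing_code (d := d)).
- move=> proper_d; suff: code_colorable 5 (size (code d)) [::].
    by rewrite size_code not_code_colorable5.
  apply: code_colorableP proper_d => _ /mapP[i _ ->].
  by rewrite mem_iota /d /= ltnS (leq_trans (ltn_ord _)).
- by move=> u; rewrite inE.
- by move=> u v _ _; rewrite /d eqSS.
Qed.

(** * The game on encoded positions *)

Definition color_code k (o : option 'I_k) : nat :=
  if o is Some c then c.+1 else 0.

Definition position_code (p : position moser_spindle) : seq nat :=
  code (fun i => color_code (p i)).

Lemma position_code_proper p :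
  partial_edge_distinguishing p = code_proper (position_code p).
Proof.
apply: edge_distinguishing_code => [u | u v _ _].
  by rewrite inE; case: (p u).
by case: (p u) (p v) => [a|] [b|].
Qed.

Lemma position_code_play p m :
  position_code (play_move p m) = set_nth 0 (position_code p) m.1 m.2.+1.
Proof.
apply: (@eq_from_nth _ 0) => [|i].
  by rewrite size_set_nth !size_code (maxn_idPr _).
rewrite size_code => lt_i; rewrite nth_set_nth /=.
have -> : i = Ordinal lt_i by [].
rewrite !nth_code /play_move -val_eqE /=.
by case: eqP.
Qed.

Lemma legal_code p m : legal p m ->
  position_code (play_move p m) \in code_moves 6 (position_code p).
Proof.
rewrite /legal position_code_proper mem_filter => /andP[mp ->]; rewrite andTb.
rewrite position_code_play; apply/allpairsP.
exists (val m.1, m.2.+1); split=> //.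
  rewrite mem_filter mem_iota ltn_ord andbT [_.1]/(val m.1) nth_code.
  by move: mp; rewrite inE negbK => /eqP->.
by rewrite mem_iota /= add1n ltnS -[X in _ < X]lambda_moser ltn_ord.
Qed.

(** Converse of [legal_code]: that one covers every move of Player 2, this one realizes the replies
    of Player 1. *)
Lemma code_legal p q : q \in code_moves 6 (position_code p) ->
  exists2 m, legal p m & position_code (play_move p m) = q.
Proof.
rewrite mem_filter => /andP[proper_q /allpairsP[[i c] [ip cP q_eq]]].
move: ip; rewrite mem_filter mem_iota => /andP[/= pi0 lt_i].
move: cP; rewrite mem_iota.
case: c q_eq => // c q_eq.
rewrite /= add1n ltnS -[X in _ < X]lambda_moser => lt_c.
pose m : move moser_spindle := (Ordinal lt_i, Ordinal lt_c).
have mq : position_code (play_move p m) = q by rewrite position_code_play q_eq.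
exists m => //; rewrite /legal position_code_proper mq proper_q andbT.
move: pi0; rewrite inE -[i]/(val m.1) nth_code negbK.
by case: (p m.1).
Qed.

Theorem theorem3p17 :
  exists s : strategy moser_spindle, player1_winning_strategy s.
Proof.
apply: (@lost_winning_strategy _ (fun p => code_lost 3 (position_code p))).
  move=> p m lost_p /legal_code mp.
  have /allP/(_ _ mp)/hasP[q /code_legal[m' legal_m' <-] lost_q] := lost_p.
  (* The reply leaves depth 2, which is raised back to 3. *)
  by exists m'; rewrite legal_m'; apply: (@code_lostS 2).
have start : position_code (position_after [::]) = nseq 7 0.
  apply: (@eq_from_nth _ 0) => [|i]; rewrite size_code // => lt_i.
  by rewrite (nth_code _ (Ordinal lt_i)) nth_nseq if_same.
have [|m legal_m m_eq] :=
  @code_legal (position_after [::]) [:: 1; 0; 0; 0; 0; 0; 0].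
  by rewrite start.
by exists m; rewrite legal_m m_eq opening_lost.
Qed.
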